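(* For all fixed integers $\tau\ge 1$ and $\sigma\ge 1$, as $n\to\infty$, $$\mathbb{P}\left(\mathcal{P}_{\tau,\sigma,n}\neq\emptyset\right)\to 1-\exp\left(-\lambda_{\tau,\sigma}\right),\qquad \text{where } \lambda_{\tau,\sigma}=\frac{1}{\tau\sigma}\sum_{d\,\mid\,\gcd(\tau,\sigma)}\varphi(d)\,d$$ and $\varphi$ is the Euler totient function. Here $\mathcal{P}_{\tau,\sigma,n}$ is the random set of periodic solutions with temporal period $\tau$ and spatial period $\sigma$ of a uniformly random two-neighbor cellular automaton rule with $n$ states.
   Context: Let $\mathbb{Z}_n=\{0,1,\dots,n-1\}$. A rule is a function $f:\mathbb{Z}_n^2\to\mathbb{Z}_n$. Given an initial configuration $\xi_0:\mathbb{Z}\to\mathbb{Z}_n$, the rule determines $\xi_t$, $t\ge 0$, by $\xi_{t+1}(x)=f(\xi_t(x-1),\xi_t(x))$ for all $x\in\mathbb{Z}$. A periodic solution (PS) of $f$ with temporal period $\tau\ge1$ and spatial period $\sigma\ge1$ is a space-time configuration $(x,t)\mapsto\xi_t(x)$ generated by $f$ such that $\sigma$ is the smallest positive integer with $\xi_0(x+\sigma)=\xi_0(x)$ for all $x\in\mathbb{Z}$, and $\tau$ is the smallest positive integer with $\xi_\tau(x)=\xi_0(x)$ for all $x\in\mathbb{Z}$. Periodic solutions that differ by a spatial and/or temporal translation are identified. The rule $f$ is chosen uniformly at random from the $n^{n^2}$ rules, i.e. $\mathbb{P}(\{f\})=1/n^{n^2}$ for each rule $f$. *)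

(* Defs.v *)
From mathcomp Require Import all_boot all_order all_algebra.
From mathcomp Require Import all_classical all_reals all_analysis.

Set Implicit Arguments.
Unset Strict Implicit.
Unset Printing Implicit Defensive.

Import Order.TTheory GRing.Theory Num.Theory.
Import numFieldNormedType.Exports.
Local Open Scope classical_set_scope.
Local Open Scope ring_scope.

Definition rule (n : nat) := {ffun 'I_n * 'I_n -> 'I_n}.

Definition spacetime (n : nat) := int -> nat -> 'I_n.

Definition generated_by (n : nat) (f : rule n) (xi : spacetime n) : Prop :=
  forall (x : int) (t : nat), xi x t.+1 = f (xi (x - 1) t, xi x t).

Definition smallest_positive (P : nat -> Prop) (k : nat) : Prop :=
  [/\ (0 < k)%N, P k & forall m : nat, (0 < m)%N -> P m -> (k <= m)%N].

Definition periodic_solution (n : nat) (f : rule n) (tau sigma : nat)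
    (xi : spacetime n) : Prop :=
  [/\ generated_by f xi,
      smallest_positive (fun s => forall x : int, xi (x + s%:Z) 0%N = xi x 0%N)
        sigma
    & smallest_positive (fun t => forall x : int, xi x t = xi x 0%N) tau].

(* On periodic solutions, the relation [eta \in translates xi] is symmetric
   although time shifts are only forward: a shift by s is undone by a further
   shift completing s to a multiple of the temporal period. *)
Definition translates (n : nat) (xi : spacetime n) : set (spacetime n) :=
  [set eta | exists (a : int) (s : nat),
      eta = fun x t => xi (x + a) (t + s)%N].

(* Periodic solutions up to space-time translation, each represented by its
   translation class. *)
Definition PS (n : nat) (f : rule n) (tau sigma : nat) :
    set (set (spacetime n)) :=
  [set translates xi | xi in periodic_solution f tau sigma].

Definition rule_prob (R : realType) (n : nat) (E : set (rule n)) : R :=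
  \sum_(f : rule n | f \in E) ((n ^ (n ^ 2))%N%:R)^-1.

Definition lambda (R : realType) (tau sigma : nat) : R :=
  ((tau * sigma)%N%:R)^-1 *
  \sum_(d <- divisors (gcdn tau sigma)) (totient d * d)%N%:R.

(* Main.v *)
(** A periodic solution is a tile, i.e. a function on the torus
    [G = Z/sigma x Z/tau] whose stabilizer under translation meets both axes
    trivially; two solutions are identified when their tiles are in the same
    orbit.  Let [N f] be the number of these orbits for the rule [f].

    The [k]-th factorial moment of [N] is a sum over [k]-tuples of tiles in
    distinct orbits, each weighted by [\prod_i |stab_i| / |G|].  The probability
    that a random rule generates a given tuple depends only on its kernel (which
    cells carry equal states): it is [n ^ - p], where [p] is the number of
    distinct pairs of neighbouring states, unless the tuple is inconsistent.
    There are [n ^_ s] tuples with that kernel, [s] being the number of states.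
    Every state is produced by a pair, so [s <= p], and only the kernels with
    [s = p] survive in the limit.  For these each state determines the pair
    producing it, so equality of states propagates backwards in time, hence, by
    periodicity, over the whole torus: equal states only occur within one tile,
    at cells in the same coset of its stabilizer.  So these kernels are the
    [k]-tuples of subgroups [H] of [G] meeting the axes trivially, and the moment
    tends to [(\sum_H |H| / |G|) ^ k].  Such [H] are cyclic, there are
    [totient d] of them of each order [d] dividing [gcd (tau, sigma)], so the
    moments tend to those of a Poisson variable with parameter [lambda], and
    Bonferroni's inequalities give the limit of [P(N = 0)]. *)

From mathcomp Require Import all_boot all_order all_fingroup all_algebra all_solvable.

Set Implicit Arguments.
Unset Strict Implicit.
Unset Printing Implicit Defensive.

Import GRing.Theory.

(** * Subgroups of a product of cyclic groups meeting the axes trivially *)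

Section AxisFree.
Local Open Scope group_scope.
Variables A B : finGroupType.

Definition axis_free (H : {set A * B}) :=
  [forall g in H, ((g.1 == 1) || (g.2 == 1)) ==> (g == 1)].

Lemma axis_freeP (H : {set A * B}) :
  reflect (forall g, g \in H -> g.1 = 1 \/ g.2 = 1 -> g = 1) (axis_free H).
Proof.
apply: (iffP forall_inP) => [F g gH h|F g gH].
  by apply/eqP; apply: (implyP (F g gH)); case: h => ->; rewrite eqxx ?orbT.
by apply/implyP => /orP h; apply/eqP/F => //; case: h => /eqP; tauto.
Qed.

Lemma expg_pair (g : A * B) k : g ^+ k = (g.1 ^+ k, g.2 ^+ k).
Proof. by elim: k => [//|k IH]; rewrite !expgS IH. Qed.

(** Raising [g] to the order of one coordinate gives an element of an axis; if it is trivial, the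
    order of the other coordinate divides that exponent. *)
Lemma axis_free_cycle (g : A * B) : axis_free <[g]> = (#[g.1] == #[g.2]).
Proof.
apply/axis_freeP/eqP => [F|E _ /cycleP[k ->]].
  have e1 : g ^+ #[g.1] = 1.
    by apply: F; [exact: mem_cycle|left; rewrite expg_pair /= expg_order].
  have e2 : g ^+ #[g.2] = 1.
    by apply: F; [exact: mem_cycle|right; rewrite expg_pair /= expg_order].
  apply/eqP; rewrite eqn_dvd !order_dvdn.
  by move: e1 e2; rewrite !expg_pair => -[_ ->] [-> _]; rewrite !eqxx.
rewrite expg_pair /= => h.
have : #[g.1] %| k by case: h => /eqP; rewrite -order_dvdn // E.
by move=> d; congr (_, _); apply/eqP; rewrite -order_dvdn -?E.
Qed.

Lemma order_pair_eq (g : A * B) : #[g.1] = #[g.2] -> #[g] = #[g.1].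
Proof.
move=> E; apply/eqP; rewrite eqn_dvd !order_dvdn !expg_pair /=.
rewrite expg_order E expg_order eqxx /=.
by have := expg_order g; rewrite expg_pair => -[-> _].
Qed.

(** The first projection is injective on [H], its kernel lying on an axis, so [H] embeds into the
    cyclic group [A]. *)
Lemma axis_free_cyclic (H : {group A * B}) :
  cyclic [set: A] -> axis_free H -> cyclic H.
Proof.
move=> cA /axis_freeP F.
pose f := restrm (subsetT H) (@fst A B).
have inj : 'injm f.
  apply/subsetP => g /morphpreP[gH /set1P e]; apply/set1P; apply: F => //; by left.
by rewrite -(injm_cyclic inj (subxx H)) (cyclicS _ cA) ?subsetT.
Qed.

End AxisFree.

Lemma card_order_cyclic (A : finGroupType) (d : nat) : cyclic [set: A] ->
  #|[set x : A | #[x]%g == d]| = if d %| #|A| then totient d else 0.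
Proof.
move=> cA; case: ifP => [dA|ndA]; last first.
  apply: eq_card0 => x; rewrite !inE; apply/negP => /eqP e.
  by rewrite -e -cardsT order_dvdG ?inE // in ndA.
have /cyclicP[a ea] := cA.
have oa : #[a]%g = #|A| by rewrite orderE -ea cardsT.
have A0 : 0 < #|A| by rewrite -oa order_gt0.
pose y := (a ^+ (#|A| %/ d))%g.
have oy : #[y]%g = d by rewrite orderXdiv oa ?dvdn_div // divnA // mulKn.
rewrite -[in RHS]oy totient_gen; apply: eq_card => x; rewrite !inE /generator.
rewrite -oy !orderE eq_sym (eq_subG_cyclic cA) ?subsetT //.
Qed.

(** Double counting of generators: those of the groups [H] counted here are exactly the pairs of
    elements of order [d], and each [H] has [totient d] of them. *)
Lemma card_axis_free (A B : finGroupType) (d : nat) :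
  cyclic [set: A] -> cyclic [set: B] -> 
  #|[set H : {group A * B} | axis_free H & #|H| == d]| =
  if d %| gcdn #|A| #|B| then totient d else 0.
Proof.
move=> cA cB.
have [->|d0] := posnP d.
  rewrite dvd0n; case: eqP => [e|_].
    have := dvdn_gcdl #|A| #|B|; rewrite e dvd0n => /eqP A0.
    by have := cardG_gt0 [set: A]%G; rewrite cardsT A0.
  by apply: eq_card0 => H; rewrite !inE eqn0Ngt cardG_gt0 andbF.
set S := [set H : {group A * B} | _ & _].
have E : #|S| * totient d = 
   #|[set x : A | #[x]%g == d]| * #|[set x : B | #[x]%g == d]|.
  rewrite -cardsX -[RHS]sum1_card -[in LHS]sum1_card.
  set D := setX _ _.
  transitivity (\sum_(H in S) \sum_(g in D | <[g]>%G == H) 1); last first.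
    rewrite [RHS](partition_big (fun g : A * B => <[g]>%G) (mem S)) //=.
    move=> [x y]; rewrite /D !inE /= => /andP[/eqP ex /eqP ey].
    by rewrite axis_free_cycle -orderE order_pair_eq /= ex ey ?eqxx.
  rewrite big_distrl /=; apply: eq_bigr => H; rewrite inE => /andP[aH /eqP cH].
  have /cyclicP[g eg] := axis_free_cyclic cA aH.
  have oH : #|H| = #[g]%g by rewrite orderE -eg.
  rewrite {}/D mul1n -cH oH totient_gen -sum1_card; apply: eq_bigl => h.
  rewrite !inE /generator -[X in _ && X]val_eqE /= eg [in RHS](eq_sym _ <[g]>%g).
  case: eqP => [e|]; last by rewrite andbF.
  have := aH; rewrite eg e axis_free_cycle => /eqP e1.
  by rewrite -e1 andbb andbT (orderE g) e -orderE order_pair_eq ?e1 ?eqxx.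
have t0 : 0 < totient d by rewrite totient_gt0.
apply/eqP; rewrite -(eqn_pmul2r t0) E !card_order_cyclic // dvdn_gcd.
by case: ifP; case: ifP; rewrite //= ?mul0n ?muln0.
Qed.

Lemma sum_card_axis_free (A B : finGroupType) :
  cyclic [set: A] -> cyclic [set: B] -> 
  \sum_(H : {group A * B} | axis_free H) #|H| =
  \sum_(d <- divisors (gcdn #|A| #|B|)) totient d * d.
Proof.
move=> cA cB.
have g0 : 0 < gcdn #|A| #|B|.
  by rewrite gcdn_gt0 -cardsT cardG_gt0.
transitivity (\sum_(H : {group A * B} | axis_free H) 
    \sum_(d <- divisors (gcdn #|A| #|B|) | #|H| == d) d).
  apply: eq_bigr => H aH.
  rewrite -big_filter (_ : [seq _ <- _ | _] = [:: #|H|]) ?big_seq1 //.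
  rewrite -(filter_pred1_uniq (divisors_uniq (gcdn #|A| #|B|))).
    by apply: eq_filter => d; rewrite /= eq_sym.
  rewrite -dvdn_divisors //.
  have := card_axis_free #|H| cA cB; case: ifP => // _ /eqP.
  by rewrite cards_eq0 => /eqP/setP/(_ H); rewrite !inE aH eqxx.
rewrite (exchange_big_dep xpredT) //=; apply: eq_big_seq => d.
rewrite -dvdn_divisors // => dg.
have := card_axis_free d cA cB; rewrite dg => <-; rewrite sum_nat_const.
by congr (_ * _); apply: eq_card => H; rewrite !inE.
Qed.

(** * Kernels of finite functions *)

Section Factor.
Variables (X S S' : finType) (h : X -> S) (h' : X -> S').
Hypothesis factor : forall x y, h x = h y -> h' x = h' y.

Let q y := if [pick x | h x == y] is Some x then Some (h' x) else None.

Let qh x : q (h x) = Some (h' x).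
Proof.
rewrite /q; case: pickP => [z /eqP/factor->//|/(_ x)]; by rewrite eqxx.
Qed.

Let imq : #|q @: [set h x | x : X]| = #|[set h' x | x : X]|.
Proof.
rewrite -[in RHS](card_imset _ (@Some_inj _)) -!imset_comp.
by congr #|pred_of_set _|; apply: eq_imset => x /=; rewrite qh.
Qed.

Lemma leq_card_imset_factor : #|[set h' x | x : X]| <= #|[set h x | x : X]|.
Proof. by rewrite -imq leq_imset_card. Qed.

(** Equal cardinalities make the induced map [q] injective on the image of [h], so the factorization
    can be reversed. *)
Lemma eq_card_imset_factor :
  #|[set h' x | x : X]| = #|[set h x | x : X]| ->
  forall x y, h' x = h' y -> h x = h y.
Proof.
rewrite -imq => /eqP/imset_injP qinj x y e.
by apply: qinj; rewrite ?imset_f // !qh e.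
Qed.

End Factor.

Lemma card_imset_same_kernel (X S S' : finType) (h : X -> S) (h' : X -> S') :
  (forall x y, (h x == h y) = (h' x == h' y)) ->
  #|[set h x | x : X]| = #|[set h' x | x : X]|.
Proof.
move=> E; apply/eqP; rewrite eqn_leq; apply/andP; split;
  by apply: leq_card_imset_factor => x y /eqP e; apply/eqP; rewrite ?E // -E.
Qed.

Section Kernel.
Variable W : finType.

(** A kernel is encoded as the map sending a point to its fibre. Being itself a function on [W], it
    is subject to every notion defined for such functions, and the kernels are the fixed points of
    [fker]. *)
Definition fker (S : finType) (F : {ffun W -> S}) : {ffun W -> {set W}} :=
  [ffun w => [set v | F v == F w]].

Lemma fkerE (S : finType) (F : {ffun W -> S}) v w :
  (fker F v == fker F w) = (F v == F w).
Proof.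
rewrite !ffunE; apply/eqP/eqP => [/setP/(_ v)|->//].
by rewrite !inE eqxx => /esym/eqP.
Qed.

Lemma fkerK (S : finType) (F : {ffun W -> S}) : fker (fker F) = fker F.
Proof. by apply/ffunP => w; apply/setP => v; rewrite ffunE inE fkerE ffunE inE. Qed.

Lemma card_fker (S : finType) (c : {ffun W -> {set W}}) : fker c = c ->
  #|[set F : {ffun W -> S} | fker F == c]| = #|S| ^_ #|[set c w | w : W]|.
Proof.
move=> cK; pose D : finType := {X | X \in [set c w | w : W]}.
have mem w : c w \in [set c w | w : W] by apply: imset_f.
pose d w : D := Sub (c w) (mem w).
have <- : #|D| = #|[set c w | w : W]| by rewrite card_sig; apply: eq_card => X; rewrite inE.
rewrite -card_inj_ffuns; pose e (g : {ffun D -> S}) := [ffun w => g (d w)].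
have dsurj (X : D) : exists w, d w = X.
  by case: X => X p; have /imsetP[w _ eX] := p; exists w; apply: val_inj.
rewrite -[RHS](card_imset _ (f := e)); last first.
  move=> g g' /ffunP E; apply/ffunP => X; have [w <-] := dsurj X.
  by have := E w; rewrite !ffunE.
apply: eq_card => F; rewrite inE; apply/eqP/imsetP => [kF|[g]]; last first.
  rewrite inE => /injectiveP ig ->; rewrite -cK.
  apply/ffunP => w; rewrite !ffunE; apply/setP => v; rewrite !inE !ffunE.
  by rewrite (inj_eq ig) -val_eqE.
have cF v w : (c v == c w) = (F v == F w) by rewrite -kF fkerE.
have pX (X : D) : exists w, d w == X by have [w <-] := dsurj X; exists w.
exists [ffun X => F (xchoose (pX X))].
  rewrite inE; apply/injectiveP => X Y; rewrite !ffunE => /eqP; rewrite -cF.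
  by move=> /eqP E; rewrite -(eqP (xchooseP (pX X))) -(eqP (xchooseP (pX Y))); apply: val_inj.
apply/ffunP => w; rewrite !ffunE; apply/eqP; rewrite -cF eq_sym.
by have /eqP/(congr1 val) := xchooseP (pX (d w)) => /= ->.
Qed.

Lemma sum_fker (R : pzSemiRingType) (S : finType) (E : {ffun W -> {set W}} -> R) :
  (\sum_(F : {ffun W -> S}) E (fker F) =
   \sum_(c | fker c == c) (#|S| ^_ #|[set c w | w : W]|)%:R * E c)%R.
Proof.
rewrite (partition_big (@fker S) (fun c => fker c == c)) /=; last by move=> F _; rewrite fkerK.
apply: eq_bigr => c /eqP cK; rewrite -(card_fker S cK) -sum1_card natr_sum big_distrl /=.
rewrite [RHS](eq_bigl (fun F => fker F == c)); last by move=> F; rewrite inE.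
by apply: eq_bigr => F /eqP ->; rewrite mul1r.
Qed.

End Kernel.

(** * Counting functions with prescribed values, and orbits *)

Lemma card_ffun_prescribed (X S : finType) (D : {set X}) (v : X -> S) :
  #|[set f : {ffun X -> S} | [forall x in D, f x == v x]]| * #|S| ^ #|D| = #|S| ^ #|X|.
Proof.
rewrite (_ : #|[set _ | _]| = #|S| ^ #|~: D|).
  by rewrite -expnD addnC cardsC.
rewrite -prod_nat_const.
transitivity #|(family (fun x => if x \in D then pred1 (v x) else predT) : simpl_pred {ffun X -> S})|.
  apply: eq_card => f; rewrite inE; apply/forall_inP/familyP => H x.
    by have := H x; case: (x \in D) => // /(_ isT).
  by move=> xD; have := H x; rewrite xD.
rewrite card_family foldrE big_map big_enum /= [RHS]big_mkcond; apply: eq_bigr => x _.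
by rewrite inE; case: (x \in D); rewrite /= ?card1 // eq_cardT.
Qed.

(* An orbit weighted by the stabilizers of its points has total weight [#|G|]. *)
Lemma ffact_card_orbits (gT : finGroupType) (X : finType) (to : {action gT &-> X})
    (G : {group gT}) (V : {set X}) (k : nat) :
  (forall x g, x \in V -> g \in G -> to x g \in V) ->
  #|orbit to G @: V| ^_ k * #|G| ^ k =
  \sum_(P : {ffun 'I_k -> X} |
      [forall i, P i \in V] && injectiveb (fun i => orbit to G (P i)))
    \prod_i #|'C_G[P i | to]%g|.
Proof.
move=> closed.
pose orb (P : {ffun 'I_k -> X}) := [ffun i => orbit to G (P i)].
have orbV x : orbit to G x \in orbit to G @: V -> x \in V.
  case/imsetP => y yV e; have : x \in orbit to G y by rewrite -e orbit_refl.
  by case/imsetP => g gG ->; apply: closed.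
(* Tuples of points are grouped by their tuples of orbits; each group is a product of orbits, over
   which the sum factors into [k] copies of [#|G|]. *)
rewrite (partition_big orb (mem [set O in ffun_on (mem (orbit to G @: V)) | injectiveb O])) /=;
  last first.
  move=> P /andP[/forallP PV /injectiveP iP]; rewrite inE; apply/andP; split.
    by apply/ffun_onP => i; rewrite ffunE imset_f.
  by apply/injectiveP => i j; rewrite !ffunE => /iP.
rewrite -[X in _ ^_ X](card_ord k) -card_inj_ffuns_on.
rewrite (eq_bigr (fun=> #|G| ^ k)) ?sum_nat_const //= => O.
rewrite inE => /andP[/ffun_onP OV /injectiveP iO].
rewrite (eq_bigl (fun P => P \in family (fun i => mem (O i)))).
  rewrite -(bigA_distr_big_dep (fun i => mem (O i)) (fun i x => #|'C_G[x | to]%g|)) /=.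
  rewrite -[in RHS](card_ord k) -prod_nat_const; apply: eq_bigr => i _.
  have /imsetP[y yV ->] := OV i.
  have orbit_gt0 z : 0 < #|orbit to G z| by apply/card_gt0P; exists z; exact: orbit_refl.
  rewrite (eq_bigr (fun=> #|'C_G[y | to]%g|)).
    by rewrite sum_nat_const card_orbit_stab.
  move=> x /orbit_eqP e.
  by apply/eqP; rewrite -(eqn_pmul2l (orbit_gt0 y)) -{1}e !card_orbit_stab.
move=> P; apply/idP/familyP => [/andP[_ /eqP <-] i|H].
  by rewrite ffunE; exact: orbit_refl.
have e i : orbit to G (P i) = O i.
  by have := H i; have /imsetP[y yV ->] := OV i => /orbit_eqP.
apply/andP; split; last by apply/eqP/ffunP => i; rewrite ffunE.
apply/andP; split; first by apply/forallP => i; apply: orbV; rewrite e; apply: OV.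
by apply/injectiveP => i j; rewrite !e => /iO.
Qed.

(** * Tiles and factorial moments *)

Section TileAction.
Local Open Scope group_scope.
Variables (gT : finGroupType) (S : finType).
Implicit Type T : {ffun gT -> S}.

Definition tmove T g : {ffun gT -> S} := [ffun h => T (g * h)].

Lemma tmove1 : tmove^~ 1 =1 id.
Proof. by move=> T; apply/ffunP => h; rewrite ffunE mul1g. Qed.

Lemma tmoveM T : act_morph tmove T.
Proof. by move=> g g'; apply/ffunP => h; rewrite !ffunE mulgA. Qed.

Definition tact := TotalAction tmove1 tmoveM.

Lemma tstabP T g : reflect (forall h, T (g * h) = T h) (g \in 'C[T | tact]).
Proof.
apply: (iffP astab1P) => [/ffunP E h|E]; first by have := E h; rewrite ffunE.
by apply/ffunP => h; rewrite ffunE.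
Qed.

Lemma torbitP T T' :
  reflect (exists g, forall h, T' h = T (g * h)) (orbit tact setT T == orbit tact setT T').
Proof.
apply: (iffP eqP) => [E|[g E]].
  have : T' \in orbit tact setT T by rewrite E orbit_refl.
  by case/orbitP => g _ <-; exists g => h; rewrite ffunE.
apply/esym/orbit_eqP/orbitP; exists g => //=.
by apply/ffunP => h; rewrite ffunE.
Qed.

End TileAction.

Section Tiles.
Variables (A B : finGroupType) (a : A) (b : B).
Hypotheses (genA : [set: A] = <[a]>%g) (genB : [set: B] = <[b]>%g).
Local Notation G := (A * B)%type.
Local Notation shift g w := (w.1, (g * w.2)%g).

(* A tile is a function on the torus [G]: the first factor is space, the second
   is time, and the automaton computes the state of [up * g] from those of
   [west * g] and [g]. *)
Definition up : G := (1%g, b).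
Definition west : G := (a^-1%g, 1%g).

Lemma mulABC (g h : G) : (g * h = h * g)%g.
Proof.
have cA : abelian [set: A] by rewrite genA cycle_abelian.
have cB : abelian [set: B] by rewrite genB cycle_abelian.
apply/eqP; rewrite xpair_eqE; apply/andP; split; apply/eqP.
  by apply: (centsP cA); rewrite inE.
by apply: (centsP cB); rewrite inE.
Qed.

Section Rule.
Variable S : finType.
Implicit Types (f : {ffun S * S -> S}) (T : {ffun G -> S}).

Definition tile_of f T :=
  [forall g, T (up * g)%g == f (T (west * g)%g, T g)].

Definition valid_tiles f :=
  [set T : {ffun G -> S} | tile_of f T & axis_free 'C[T | tact G S]%g].

Definition nb_orbits f := #|orbit (tact G S) setT @: valid_tiles f|.

Lemma valid_tiles_move f T g : T \in valid_tiles f -> tmove T g \in valid_tiles f.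
Proof.
rewrite !inE => /andP[/forallP V F]; apply/andP; split.
  apply/forallP => h; rewrite !ffunE.
  by have := V (g * h)%g; rewrite !mulgA ![(_ * g)%g]mulABC.
rewrite (_ : 'C[_ | _]%g = 'C[T | tact G S]%g) //.
apply/setP => h; apply/tstabP/tstabP => E x.
  by have := E (g^-1 * x)%g; rewrite !ffunE mulgA mulKVg [(g * h)%g]mulABC -mulgA mulKVg.
by rewrite !ffunE mulgA [(g * h)%g]mulABC -mulgA.
Qed.

End Rule.

(** * Tuples of tiles and their kernels *)

Section Families.
Variables (k : nat).
Local Notation W := ('I_k * G)%type.

Definition tile (S : finType) (F : {ffun W -> S}) : {ffun 'I_k -> {ffun G -> S}} :=
  [ffun i => [ffun g => F (i, g)]].

Definition stab (S : finType) (F : {ffun W -> S}) (i : 'I_k) : {group G} :=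
  'C[tile F i | tact G S]%G.

(* A stabilizer meeting both axes trivially means that the sides of the torus
   are the minimal periods of the tile. *)
Definition admissible (S : finType) (F : {ffun W -> S}) :=
  [forall i, axis_free (stab F i)] &&
  injectiveb (fun i => orbit (tact G S) setT (tile F i)).

Definition below (S : finType) (F : {ffun W -> S}) (w : W) :=
  (F (shift west w), F w).

Definition nb_pairs (S : finType) (F : {ffun W -> S}) := #|[set below F w | w : W]|.

Definition nb_states (S : finType) (F : {ffun W -> S}) := #|[set F w | w : W]|.

Definition deterministic (S : finType) (F : {ffun W -> S}) :=
  [forall w, forall v, (below F w == below F v) ==>
     (F (shift up w) == F (shift up v))].

Lemma tileE (S : finType) (F : {ffun W -> S}) i g : tile F i g = F (i, g).
Proof. by rewrite !ffunE. Qed.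

Lemma stabP (S : finType) (F : {ffun W -> S}) i g :
  reflect (forall h, F (i, g * h)%g = F (i, h)) (g \in stab F i).
Proof. by apply: (iffP (tstabP _ _)) => E h; have := E h; rewrite !tileE. Qed.

Section Invariance.
Variables (S S' : finType) (F : {ffun W -> S}) (F' : {ffun W -> S'}).
Hypothesis sameker : forall v w, (F v == F w) = (F' v == F' w).

Let sk v w : F v = F w <-> F' v = F' w.
Proof. by split=> /eqP E; apply/eqP; rewrite ?sameker // -sameker. Qed.

Lemma stab_same_kernel i : stab F i = stab F' i.
Proof.
apply/val_inj/setP => g.
by apply/stabP/stabP => E h; apply/sk; apply: E.
Qed.

Lemma admissible_same_kernel : admissible F = admissible F'.
Proof.
rewrite /admissible; congr (_ && _).
  by apply: eq_forallb => i; rewrite stab_same_kernel.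
suff E i j : (orbit (tact G S) setT (tile F i) == orbit (tact G S) setT (tile F j)) =
   (orbit (tact G S') setT (tile F' i) == orbit (tact G S') setT (tile F' j)).
  apply/injectiveP/injectiveP => I i j /eqP; first by rewrite -E => /eqP/I.
  by rewrite E => /eqP/I.
by apply/torbitP/torbitP => -[g E]; exists g => h; have := E h; rewrite !tileE => /sk.
Qed.

Lemma nb_pairs_same_kernel : nb_pairs F = nb_pairs F'.
Proof. by apply: card_imset_same_kernel => v w; rewrite !xpair_eqE !sameker. Qed.

Lemma deterministic_same_kernel : deterministic F = deterministic F'.
Proof.
by apply: eq_forallb => w; apply: eq_forallb => v; rewrite !xpair_eqE !sameker.
Qed.

End Invariance.

Definition solves (S : finType) (f : {ffun S * S -> S}) (F : {ffun W -> S}) :=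
  [forall i, tile_of f (tile F i)].

(** [F] prescribes the values of a generating rule on [nb_pairs F] arguments, consistently if and
    only if [F] is deterministic, and leaves the other values free. The product form avoids dividing
    by a power of [#|S|]. *)
Lemma card_solves (S : finType) (s0 : S) (F : {ffun W -> S}) :
  #|[set f | solves f F]| * #|S| ^ nb_pairs F = deterministic F * #|S| ^ (#|S| ^ 2).
Proof.
have solvesE f : solves f F = [forall w, f (below F w) == F (shift up w)].
  apply/forallP/forallP => [E [i g]|E i].
    by have /forallP/(_ g) := E i; rewrite !tileE eq_sym.
  by apply/forallP => g; have := E (i, g); rewrite !tileE eq_sym.
case: (boolP (deterministic F)) => [/forallP D|nD]; last first.
  rewrite mul0n; apply/eqP; rewrite muln_eq0 cards_eq0; apply/orP; left.
  apply/eqP/setP => f; rewrite !inE; apply: contraNF nD.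
  rewrite solvesE => /forallP E; apply/forallP => w; apply/forallP => v.
  by apply/implyP => /eqP e; rewrite -(eqP (E w)) -(eqP (E v)) e.
pose v x := if [pick w | below F w == x] is Some w then F (shift up w) else s0.
rewrite mul1n -mulnn -[in RHS]card_prod -(card_ffun_prescribed [set below F w | w : W] v).
congr (_ * _); apply: eq_card => f; rewrite !inE solvesE.
have vE w : v (below F w) = F (shift up w).
  rewrite /v; case: pickP => [w' /eqP e|/(_ w)]; last by rewrite eqxx.
  by apply/eqP; apply: (implyP (forallP (D w') w)); rewrite e.
apply/forallP/forall_inP => [E _ /imsetP[w _ ->]|E w]; first by rewrite vE.
by rewrite -vE; apply: E; rewrite imset_f.
Qed.

Lemma sum_ffact_nb_orbits (S : finType) :
  (\sum_(f : {ffun S * S -> S}) nb_orbits f ^_ k) * #|{: G}| ^ k =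
  \sum_(F : {ffun W -> S} | admissible F)
    #|[set f | solves f F]| * \prod_i #|stab F i|.
Proof.
rewrite big_distrl /=.
transitivity (\sum_(f : {ffun S * S -> S}) \sum_(F : {ffun W -> S} | admissible F && solves f F)
    \prod_i #|stab F i|).
  apply: eq_bigr => f _; rewrite -[#|{: G}|]cardsT.
  rewrite (@ffact_card_orbits _ _ (tact G S) [set: G]%G (valid_tiles f) k); last first.
    by move=> T g TV _; apply: valid_tiles_move.
  pose unc (P : {ffun 'I_k -> {ffun G -> S}}) : {ffun W -> S} := [ffun w => P w.1 w.2].
  rewrite (reindex_onto (@tile S) unc) /=.
    apply: eq_big => [F|F _].
      rewrite /admissible /solves [RHS]andbC andbA.
      rewrite (_ : unc _ == _); last first.
        by apply/eqP/ffunP => -[i g]; rewrite !ffunE.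
      rewrite andbT; congr (_ && _); apply/forallP/andP => [E|[/forallP E /forallP E'] i].
        by split; apply/forallP => i; have := E i; rewrite !inE => /andP[].
      by rewrite !inE E E'.
    by apply: eq_bigr => i _; rewrite setTI.
  by move=> P _; apply/ffunP => i; apply/ffunP => g; rewrite !ffunE.
rewrite (exchange_big_dep (@admissible S)) /=; last by move=> f F _ /andP[].
apply: eq_bigr => F aF; rewrite sum_nat_const; congr (_ * _).
by apply: eq_card => f; rewrite !inE unfold_in /= aF.
Qed.

(** In the sum over tuples every summand depends only on the kernel, so tuples are grouped by
    kernel. The index set on the right does not involve [S], which later allows a limit term by
    term. *)
Lemma moment_by_kernel (R : numFieldType) (S : finType) : 0 < #|S| ->
  ((\sum_(f : {ffun S * S -> S}) (nb_orbits f ^_ k)%:R) / (#|S| ^ (#|S| ^ 2))%:R =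
  \sum_(c : {ffun W -> {set W}} | [&& fker c == c, admissible c & deterministic c])
    (\prod_i (#|stab c i|%:R / #|{: G}|%:R)) *
      ((#|S| ^_ nb_states c)%:R / (#|S| ^ nb_pairs c)%:R) :> R)%R.
Proof.
move=> S0; have /card_gt0P[s0 _] := S0.
have G0 : 0 < #|{: G}| by rewrite -cardsT cardG_gt0.
have nzG : ((#|{: G}|%:R : R) != 0)%R by rewrite Num.Theory.pnatr_eq0 -lt0n.
have nzGk : ((#|{: G}| ^ k)%:R != 0 :> R)%R.
  by rewrite Num.Theory.pnatr_eq0 -lt0n expn_gt0 G0.
rewrite -natr_sum; set M := (\sum_f _)%N.
have -> : (M%:R = (M * #|{: G}| ^ k)%:R / (#|{: G}| ^ k)%:R :> R)%R by rewrite natrM mulfK.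
rewrite sum_ffact_nb_orbits natr_sum !big_distrl /=.
pose E (c : {ffun W -> {set W}}) : R := if admissible c && deterministic c then
  (((\prod_i (#|stab c i|%:R / #|{: G}|%:R)) / (#|S| ^ nb_pairs c)%:R))%R else 0%R.
transitivity (\sum_(F : {ffun W -> S}) E (fker F))%R.
  rewrite big_mkcond /=; apply: eq_bigr => F _; rewrite /E.
  rewrite (admissible_same_kernel (fkerE F)) (deterministic_same_kernel (fkerE F)).
  rewrite (nb_pairs_same_kernel (fkerE F)).
  case: (boolP (admissible F)) => //= _; have := card_solves s0 F.
  case: (boolP (deterministic F)) => /= _; last first.
    move=> /eqP; rewrite mul0n muln_eq0 expn_eq0 (gtn_eqF S0) /= orbF => /eqP ->.
    by rewrite mul0n !mul0r.
  rewrite mul1n; set m := #|[set f | _]| => em.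
  have nzm : (m%:R != 0 :> R)%R.
    rewrite Num.Theory.pnatr_eq0; apply: contra_eq_neq em => ->.
    by rewrite mul0n eq_sym expn_eq0 (gtn_eqF S0).
  rewrite -em.
  rewrite prodf_div prodr_const card_ord -natrX natrM natr_prod.
  have -> : (\prod_i #|stab (fker F) i|%:R = \prod_i #|stab F i|%:R :> R)%R.
    apply: eq_bigr => i _.
    by rewrite (congr1 (fun K : {group G} => #|K|) (stab_same_kernel (fkerE F) i)).
  by rewrite natrM -(mulrA m%:R)%R invfM mulrACA divff // mul1r.
rewrite sum_fker.
rewrite [RHS]big_mkcondr /=; apply: eq_bigr => c _; rewrite /E.
case: ifP => _; last by rewrite mulr0.
by rewrite mulrCA.
Qed.

(** * Kernels with as many states as pairs *)

Section Simple.
Variables (S : finType) (F : {ffun W -> S}).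

Lemma nb_statesE : nb_states F = #|[set F (shift up w) | w : W]|.
Proof.
congr #|pred_of_set _|; apply/setP => s; apply/imsetP/imsetP => -[[i g] _ ->].
  by exists (i, (up^-1 * g)%g) => //=; rewrite mulKVg.
by exists (i, (up * g)%g).
Qed.

Lemma leq_nb_states_pairs : deterministic F -> nb_states F <= nb_pairs F.
Proof.
move=> /forallP D.
rewrite nb_statesE.
by apply: leq_card_imset_factor => w v /eqP e; apply/eqP/(implyP (forallP (D w) v)).
Qed.

Hypotheses (detF : deterministic F) (admF : admissible F).
Hypothesis simple : nb_states F = nb_pairs F.

(** With as many states as pairs, the map from pairs onto the states they produce is injective. *)
Let back (w v : W) : F (shift up w) = F (shift up v) ->
  F (shift west w) = F (shift west v) /\ F w = F v.
Proof.
have D := forallP detF.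
move=> e; have := simple; rewrite nb_statesE => /eq_card_imset_factor.
have Dv x y : below F x = below F y -> F (shift up x) = F (shift up y).
  by move=> /eqP e'; apply/eqP/(implyP (forallP (D x) y)).
by move=> /(_ Dv) /(_ _ _ e) [-> ->].
Qed.

(* Invariance under [up^-1] and [west * up^-1] suffices: the translations
   preserving equality of states form a submonoid, hence a subgroup, of [G]. *)
Let invariant g := forall w v : W, F w = F v -> F (shift g w) = F (shift g v).

Let invariantM g h : invariant g -> invariant h -> invariant (g * h)%g.
Proof. by move=> ig ih w v /ih/ig; rewrite /= !mulgA. Qed.

Let invariantX g n : invariant g -> invariant (g ^+ n)%g.
Proof.
move=> ig; elim: n => [[i x] [j y] /= e|n IH]; first by rewrite !mul1g.
by rewrite expgS; apply: invariantM.
Qed.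

Let invariant_all g : invariant g.
Proof.
have i1 : invariant up^-1%g.
  by move=> [i x] [j y] e; have [] := @back (i, up^-1 * x)%g (j, up^-1 * y)%g; rewrite //= !mulKVg.
have i2 : invariant (west * up^-1)%g.
  move=> [i x] [j y] e; have [] := @back (i, up^-1 * x)%g (j, up^-1 * y)%g; rewrite /= ?mulKVg //.
  by rewrite !mulgA.
(* The power [m] realizes the space coordinate of [g]; each factor [west * up^-1] also goes back one
   time step, which the choice of [n] compensates. *)
have /cycleP[m em] : g.1 \in <[a^-1]>%g by rewrite cycleV -genA inE.
have /cycleP[n en] : (g.2 * b ^+ m)%g \in <[b^-1]>%g by rewrite cycleV -genB inE.
have -> : g = ((west * up^-1) ^+ m * up^-1 ^+ n)%g.
  rewrite !expg_pair [LHS]surjective_pairing; congr (_, _) => /=.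
    by rewrite em invg1 expg1n mulg1 mulg1.
  rewrite mul1g -en.
  have [<-] := mulABC (1, b ^+ m)%g (1, g.2)%g.
  by rewrite expgVn mulKg.
by apply: invariantM; apply: invariantX.
Qed.

(** By invariance, one equality of states between two tiles makes one a translate of the other.
    Different tiles have different orbits, so it is the same tile and the translation lies in its
    stabilizer. *)
Lemma simple_kernel (w v : W) :
  (F w == F v) = (w.1 == v.1) && ((w.2 * v.2^-1)%g \in stab F v.1).
Proof.
case: w v => [i g] [j h] /=.
have [eF|neF] := eqVneq (F (i, g)) (F (j, h)).
  have E x : F (j, x) = F (i, g * h^-1 * x)%g.
    have := invariant_all (x * h^-1)%g eF.
    by rewrite /= mulgKV => <-; rewrite [(_ * g)%g]mulABC [(x * _)%g]mulABC mulgA.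
  have eij : i = j.
    have /andP[_ /injectiveP I] := admF; apply: I; apply/eqP/torbitP.
    by exists (g * h^-1)%g => x; rewrite !tileE.
  by rewrite eij eqxx; apply/esym/stabP => x; rewrite [RHS]E eij.
apply/esym/negbTE; apply: contra neF => /andP[/eqP -> /stabP E].
by have := E h; rewrite mulgKV => ->.
Qed.

End Simple.

Definition coset_kernel (H : {ffun 'I_k -> {group G}}) : {ffun W -> {set W}} :=
  [ffun w => [set v | (v.1 == w.1) && ((v.2 * w.2^-1)%g \in H w.1)]].

Lemma coset_kernelE (H : {ffun 'I_k -> {group G}}) v w :
  (coset_kernel H v == coset_kernel H w) = (v.1 == w.1) && ((v.2 * w.2^-1)%g \in H w.1).
Proof.
rewrite !ffunE; apply/eqP/andP => [/setP/(_ v)|[/eqP e m]].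
  by rewrite !inE eqxx mulgV group1 => /esym/andP.
apply/setP => x; rewrite !inE e; congr (_ && _).
by rewrite -(groupMr (x.2 * v.2^-1)%g m) -mulgA mulKg.
Qed.

Lemma stab_coset_kernel (H : {ffun 'I_k -> {group G}}) i : stab (coset_kernel H) i = H i.
Proof.
apply/val_inj/setP => g; apply/stabP/idP => [/(_ 1%g)/eqP|gH h].
  by rewrite coset_kernelE /= eqxx mulg1 invg1 mulg1.
by apply/eqP; rewrite coset_kernelE /= eqxx mulgK.
Qed.

(** [coset_kernel] and [stab] are inverse bijections between tuples of axis-free subgroups and the
    kernels summed over; the sum over tuples then factors. *)
Lemma sum_simple_kernels :
  \sum_(c : {ffun W -> {set W}} |
      [&& fker c == c, admissible c, deterministic c & nb_states c == nb_pairs c])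
    \prod_i #|stab c i| =
  (\sum_(H : {group G} | axis_free H) #|H|) ^ k.
Proof.
rewrite (reindex_onto coset_kernel (fun c => [ffun i => stab c i])) /=; last first.
  move=> c /and4P[/eqP cK adm det /eqP s].
  apply/ffunP => w; rewrite -{2}cK !ffunE; apply/setP => v; rewrite !in_set.
  by rewrite (simple_kernel det adm s) !inE.
rewrite -[in RHS](card_ord k) -prod_nat_const bigA_distr_big /=.
apply: eq_big => [H|H _]; last first.
  apply: eq_bigr => i _.
  exact: (congr1 (fun K : {group G} => #|K|) (stab_coset_kernel H i)).
have -> : [ffun i => stab (coset_kernel H) i] == H.
  by apply/eqP/ffunP => i; rewrite ffunE stab_coset_kernel.
rewrite andbT; apply/and4P/ffun_onP => [[_ /andP[/forallP E _] _ _] i|E].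
  by have := E i; rewrite stab_coset_kernel.
(* Coset kernels are invariant under all translations, so equality of states at two cells amounts to
   equality of their pairs and to equality one time step later. *)
have shiftE g v w : (coset_kernel H v == coset_kernel H w) =
    (coset_kernel H (shift g v) == coset_kernel H (shift g w)).
  rewrite !coset_kernelE /=.
  suff -> : (g * v.2 * (g * w.2)^-1 = v.2 * w.2^-1)%g by [].
  by rewrite invMg mulABC mulgA mulgKV mulABC.
split.
- by apply/eqP/ffunP => w; apply/setP => v; rewrite {1}/fker ffunE in_set coset_kernelE ffunE in_set.
- apply/andP; split; first by apply/forallP => i; rewrite stab_coset_kernel; apply: E.
  apply/injectiveP => i j /eqP/torbitP[g /(_ 1%g)/eqP].
  by rewrite !tileE coset_kernelE /= => /andP[/eqP->].
- apply/forallP => w; apply/forallP => v; apply/implyP; rewrite xpair_eqE => /andP[_].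
  by rewrite (shiftE up).
- apply/eqP; apply: card_imset_same_kernel => v w.
  by rewrite xpair_eqE -(shiftE west) andbb.
Qed.

End Families.
End Tiles.

(** * The Poisson limit *)

Require Import Defs.
From mathcomp Require Import lra.
From mathcomp Require Import all_classical all_reals all_analysis.

Import Order.TTheory GRing.Theory Num.Theory.
Import numFieldNormedType.Exports.
Local Open Scope classical_set_scope.
Local Open Scope ring_scope.

Lemma sum_signed_bin (N K : nat) (R : pzRingType) :
  \sum_(k < K.+1) (-1) ^+ k * 'C(N.+1, k)%:R = (-1) ^+ K * 'C(N, K)%:R :> R.
Proof.
elim: K => [|K IH]; first by rewrite big_ord_recl big_ord0 !bin0 addr0.
by rewrite big_ord_recr /= IH binS natrD exprS mulN1r !mulNr mulrDr opprD addrCA subrr addr0.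
Qed.

(** For positive [N] and [K] the truncated alternating sum has absolute value ['C(N - 1, K - 1)], at
    most ['C(N, K)] by Pascal's rule. *)
Lemma bonferroni (R : realDomainType) (N K : nat) :
  `|(N == 0)%:R - \sum_(k < K) (-1) ^+ k * 'C(N, k)%:R| <= 'C(N, K)%:R :> R.
Proof.
case: N => [|N].
  case: K => [|K]; first by rewrite big_ord0 subr0 bin0 normr1.
  rewrite big_ord_recl expr0 mul1r big1 => [|i _]; last by rewrite bin0n mulr0.
  by rewrite bin0 addr0 subrr normr0 ler0n.
rewrite sub0r normrN; case: K => [|K]; first by rewrite big_ord0 normr0 ler0n.
by rewrite sum_signed_bin normrM normrX normrN1 expr1n mul1r normr_nat ler_nat binS leq_addl.
Qed.

Lemma cvg_finsum (R : realFieldType) (I : finType) (P : pred I)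
    (u : I -> R^nat) (l : I -> R) :
  (forall i, P i -> u i @ \oo --> l i) ->
  (fun n => \sum_(i | P i) u i n) @ \oo --> \sum_(i | P i) l i.
Proof.
move=> H.
have -> : (fun n => \sum_(i | P i) u i n) = \sum_(i | P i) u i.
  by apply/funext => n; rewrite fct_sumE.
rewrite big_mkcond [X in _ --> X]big_mkcond /=.
elim: (index_enum I) => [|i r IH]; first by rewrite !big_nil; exact: cvg_cst.
rewrite !big_cons; apply: cvgD => //.
by case: (boolP (P i)) => [/H//|_]; exact: cvg_cst.
Qed.

Lemma cvg_natV (R : realType) : (fun n => (n%:R)^-1 : R) @ \oo --> (0 : R).
Proof.
apply/gtr0_cvgV0; last exact: cvgr_idn.
by near=> n; rewrite ltr0n; near: n; exact: nbhs_infty_gt.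
Unshelve. all: by end_near. Qed.

Lemma cvg_ffact_ratio (R : realType) (s : nat) :
  (fun n => (n ^_ s)%:R / (n ^ s)%:R : R) @ \oo --> (1 : R).
Proof.
elim: s => [|s IH].
  rewrite (_ : (fun _ => _) = fun=> 1); first exact: cvg_cst.
  by apply/funext => n; rewrite ffactn0 expn0 divr1.
have H : (fun n => ((n ^_ s)%:R / (n ^ s)%:R) * (1 - s%:R * (n%:R)^-1) : R) @ \oo
    --> (1 * (1 - s%:R * 0) : R).
  apply: cvgM => //; apply: cvgB; first exact: cvg_cst.
  by apply: cvgM; [exact: cvg_cst|exact: cvg_natV].
rewrite mulr0 subr0 mulr1 in H.
apply: cvg_trans H; apply: near_eq_cvg; near=> n.
have sn : (s <= n)%N by near: n; exact: nbhs_infty_ge.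
have n0 : (n%:R != 0 :> R) by rewrite pnatr_eq0 -lt0n; near: n; exact: nbhs_infty_gt.
rewrite ffactnSr expnSr !natrM natrB // invfM mulrACA.
by rewrite mulrBl divff.
Unshelve. all: by end_near. Qed.

(** The quotient behaves like [n] to the power [s - p], so only kernels with as many states as pairs
    contribute in the limit. *)
Lemma cvg_ffact_pow (R : realType) (s p : nat) : (s <= p)%N ->
  (fun n => (n ^_ s)%:R / (n ^ p)%:R : R) @ \oo --> ((s == p)%:R : R).
Proof.
move=> /subnKC <-; set d := (p - s)%N.
have -> : (s == s + d)%N%:R = 0 ^+ d :> R.
  by rewrite -{1}[s]addn0 eqn_add2l expr0n eq_sym.
rewrite -[X in _ --> X]mul1r.
have -> : (fun n => (n ^_ s)%:R / (n ^ (s + d))%:R : R) =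
  (fun n => ((n ^_ s)%:R / (n ^ s)%:R) * (n%:R)^-1 ^+ d).
  by apply/funext => n; rewrite expnD natrM invfM mulrA natrX (natrX _ n d) exprVn.
apply: cvgM; first exact: cvg_ffact_ratio.
elim: d => [|d IH].
  by under eq_fun do rewrite expr0; rewrite expr0; exact: cvg_cst.
under eq_fun do rewrite exprS.
by rewrite exprS; apply: cvgM; first exact: cvg_natV.
Qed.

(** Exchange of limits: [K] is chosen first, making [V K] close to [l] and [W K] small, then [n] is
    taken large depending on [K]. Four errors of [e / 4] add up. *)
Lemma cvg_sandwich_approx (R : realFieldType) (u : R^nat) (v w : nat -> R^nat)
    (V W : R^nat) (l : R) :
  (forall K, \forall n \near \oo, `|u n - v K n| <= w K n) ->
  (forall K, v K @ \oo --> V K) -> (forall K, w K @ \oo --> W K) ->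
  V @ \oo --> l -> W @ \oo --> (0 : R) -> u @ \oo --> l.
Proof.
move=> uvw cv cw cV cW; apply/cvgrPdist_lt => e e0.
have e4 : 0 < e / 4 by rewrite divr_gt0.
near \oo => K.
have hV : `|l - V K| < e / 4 by near: K; move/cvgrPdist_lt : cV; apply.
have hW : `|0 - W K| < e / 4 by near: K; move/cvgrPdist_lt : cW; apply.
near=> n.
have hv : `|V K - v K n| < e / 4 by near: n; move/cvgrPdist_lt : (cv K); apply.
have hw : `|W K - w K n| < e / 4 by near: n; move/cvgrPdist_lt : (cw K); apply.
have hu : `|u n - v K n| <= w K n by near: n.
move: hV hW hv hw hu; rewrite !ltr_norml ler_norml.
by move=> *; apply/andP; split; lra.
Unshelve. all: by end_near. Qed.

(** * Limits of the moments and of the probability of no orbit *)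

Section Poisson.
Variables (R : realType) (A B : finGroupType) (a : A) (b : B).
Hypotheses (genA : [set: A]%SET = <[a]>%g) (genB : [set: B]%SET = <[b]>%g).

Definition intensity : R :=
  (\sum_(H : {group A * B} | axis_free H) #|H|)%N%:R / #|{: A * B}|%:R.

(** The expansion over kernels has a fixed finite index set; in the limit only kernels with as many
    states as pairs keep their weight, and [sum_simple_kernels] adds these weights up. *)
Lemma cvg_moment (k : nat) :
  (fun n => (\sum_(f : {ffun 'I_n * 'I_n -> 'I_n}) (nb_orbits a b f ^_ k)%:R)
     / (n ^ (n ^ 2))%:R) @ \oo --> intensity ^+ k.
Proof.
pose P (c : {ffun 'I_k * (A * B) -> {set 'I_k * (A * B)}}) :=
  [&& fker c == c, admissible c & deterministic a b c].
pose wt (c : {ffun 'I_k * (A * B) -> {set 'I_k * (A * B)}}) : R :=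
  \prod_i (#|stab c i|%:R / #|{: A * B}|%:R).
suff H : (fun n => \sum_(c | P c) wt c * ((n ^_ nb_states c)%:R / (n ^ nb_pairs a c)%:R))
    @ \oo --> intensity ^+ k.
  apply: cvg_trans H; apply: near_eq_cvg; near=> n.
  have n0 : (0 < #|'I_n|)%N by rewrite card_ord; near: n; exact: nbhs_infty_gt.
  by have := moment_by_kernel genA genB k R n0; rewrite !card_ord => ->.
have -> : intensity ^+ k = \sum_(c | P c) wt c * (nb_states c == nb_pairs a c)%:R.
  have := sum_simple_kernels genA genB k => /(congr1 (fun m => m%:R / (#|{: A * B}| ^ k)%:R : R)).
  rewrite natrX natrX -expr_div_n -/intensity => <-.
  rewrite natr_sum mulr_suml.
  rewrite [RHS](eq_bigr (fun c => if nb_states c == nb_pairs a c then wt c else 0)); last first.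
    by move=> c _; case: ifP => _; rewrite ?mulr1 ?mulr0.
  rewrite -big_mkcondr /=; apply: eq_big => [c|c _]; first by rewrite /P -!andbA.
  by rewrite /wt prodf_div prodr_const card_ord natr_prod.
apply: cvg_finsum => c /and3P[_ _ det].
apply: cvgM; first exact: cvg_cst.
by apply: cvg_ffact_pow; exact: (leq_nb_states_pairs det).
Unshelve. all: by end_near. Qed.

(** Bonferroni's inequality is averaged over the rules. As [n] grows, the truncated sums tend to
    partial sums of the series of [expR (- intensity)], and the error bound to a term of the series
    of [expR intensity], which vanishes as [K] grows. *)
Lemma cvg_no_orbit :
  (fun n => (\sum_(f : {ffun 'I_n * 'I_n -> 'I_n}) (nb_orbits a b f == 0)%:R)
     / (n ^ (n ^ 2))%:R) @ \oo --> expR (- intensity).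
Proof.
pose M k n : R := (\sum_(f : {ffun 'I_n * 'I_n -> 'I_n}) (nb_orbits a b f ^_ k)%:R)
     / (n ^ (n ^ 2))%:R.
have facN0 k : (k`!%:R != 0 :> R) by rewrite pnatr_eq0 -lt0n fact_gt0.
have ME k n : M k n / k`!%:R =
    (\sum_(f : {ffun 'I_n * 'I_n -> 'I_n}) 'C(nb_orbits a b f, k)%:R) / (n ^ (n ^ 2))%:R.
  rewrite /M mulrAC mulr_suml; congr (_ / _); apply: eq_bigr => f _.
  by rewrite -bin_ffact natrM mulfK.
apply: (@cvg_sandwich_approx _ _ (fun K n => \sum_(k < K) (-1) ^+ k * (M k n / k`!%:R))
   (fun K n => M K n / K`!%:R) (series (exp_coeff (- intensity)))
   (exp_coeff intensity)).
- move=> K; near=> n; rewrite ME.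
  under [X in `|_ - X|]eq_bigr => k _ do rewrite ME mulrA mulr_sumr.
  rewrite -mulr_suml exchange_big -mulrBl -sumrB normrM.
  rewrite [X in _ * X]ger0_norm ?invr_ge0 ?ler0n //.
  rewrite ler_wpM2r ?invr_ge0 ?ler0n //.
  apply: le_trans (ler_norm_sum _ _ _) _; apply: ler_sum => f _.
  exact: bonferroni.
- move=> K.
  rewrite /series /= big_mkord.
  apply: cvg_finsum => k _ /=.
  rewrite /exp_coeff /= [(- intensity) ^+ _]exprNn -[X in _ --> X]mulrA.
  apply: cvgM; first exact: cvg_cst.
  by apply: cvgM; [exact: cvg_moment|exact: cvg_cst].
- move=> K; apply: cvgM; [exact: cvg_moment|exact: cvg_cst].
- exact: is_cvg_series_exp_coeff.
- exact: cvg_exp_coeff.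
Unshelve. all: by end_near. Qed.

End Poisson.

(** * Periodic solutions and tiles *)

Section Wrap.
Variable m : nat.

(** Reduction modulo [m.+1], as a homomorphism from the integers; products in [%g] on ['I_m.+1] are
    sums of residues. *)
Definition wrap (x : int) : 'I_m.+1 := Zp1 *~ x.

Lemma wrap_nat (k : nat) : wrap k%:Z = inZp k.
Proof. by rewrite /wrap -pmulrn Zp_mulrn; apply/val_inj; rewrite /= modnMml mul1n. Qed.

Lemma wrapD x y : wrap (x + y) = (wrap x * wrap y)%g.
Proof. exact: mulrzDr. Qed.

Lemma wrap0 : wrap 0 = 1%g.
Proof. by []. Qed.

Lemma wrapB1 x : wrap (x - 1) = (Zp1^-1 * wrap x)%g.
Proof. by rewrite addrC wrapD. Qed.

Lemma wrapS (k : nat) : wrap k.+1%:Z = (Zp1 * wrap k%:Z)%g.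
Proof. by rewrite intS wrapD. Qed.

Lemma wrap_val (i : 'I_m.+1) : wrap (i : nat)%:Z = i.
Proof. by rewrite wrap_nat valZpK. Qed.

Lemma wrap_period : wrap (m.+1)%:Z = 1%g.
Proof. by rewrite wrap_nat; apply: val_inj; rewrite /= modnn. Qed.

Lemma wrap_eq1 (k : nat) : wrap k%:Z = 1%g -> (m.+1 %| k)%N.
Proof. by rewrite wrap_nat => /(congr1 val) /= /eqP. Qed.

Lemma wrapE x : exists q : int, x = q * (m.+1)%:Z + (wrap x : nat)%:Z.
Proof.
exists (x %/ (m.+1)%:Z)%Z.
have r0 : (0 <= x %% (m.+1)%:Z)%Z by apply: modz_ge0.
have rm : (x %% (m.+1)%:Z < (m.+1)%:Z)%Z by apply: ltz_pmod.
have E := divz_eq x (m.+1)%:Z.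
rewrite {1}E; congr (_ + _).
have -> : wrap x = wrap (x %% (m.+1)%:Z)%Z.
  rewrite {1}E wrapD /wrap mulrC mulrzA.
  by rewrite (wrap_period : Zp1 *~ (m.+1)%:Z = 0) mul0rz; exact: mul1g.
case: (x %% _)%Z r0 rm => // k _; rewrite ltz_nat => km.
by rewrite wrap_nat /= modn_small.
Qed.

Lemma wrap_natE (k : nat) : exists q : nat, k = (q * m.+1 + (wrap k%:Z : nat))%N.
Proof. by exists (k %/ m.+1)%N; rewrite wrap_nat /= -divn_eq. Qed.

End Wrap.

Section Solutions.
Variables (n s t : nat) (f : rule n).
Local Notation G := ('I_s.+1 * 'I_t.+1)%type.

Lemma spatial_period_all (xi : spacetime n) (m : int) : generated_by f xi ->
  (forall x, xi (x + m) 0%N = xi x 0%N) -> forall k x, xi (x + m) k = xi x k.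
Proof. by move=> g p; elim=> [//|k IH] x; rewrite !g addrAC !IH. Qed.

Lemma temporal_period_all (xi : spacetime n) (m : nat) : generated_by f xi ->
  (forall x, xi x m = xi x 0%N) -> forall k x, xi x (k + m)%N = xi x k.
Proof. by move=> g p; elim=> [//|k IH] x; rewrite addSn !g !IH. Qed.

(** A period along one axis gives a stabilizer element on that axis, which must be trivial, so the
    side of the torus divides the period. *)
Lemma solution_of_tile (T : {ffun G -> 'I_n}) :
  T \in valid_tiles Zp1 Zp1 f ->
  periodic_solution f t.+1 s.+1 (fun x k => T (wrap s x, wrap t k%:Z)).
Proof.
rewrite inE => /andP[/forallP V /axis_freeP F].
set xi := fun _ _ => _.
have g : generated_by f xi.
  move=> x k; have /eqP := V (wrap s x, wrap t k%:Z).
  rewrite /xi wrapB1 wrapS => e; apply: etrans (etrans e _).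
    by congr (T (_, _)); rewrite mul1g.
  by congr (f (T (_, _), T (_, _))); rewrite mul1g.
have stabx (m : int) : (forall x k, xi (x + m) k = xi x k) -> wrap s m = 1%g.
  move=> p; suff /F : (wrap s m, 1%g) \in 'C[T | tact G 'I_n]%g.
    by move=> /(_ (or_intror erefl)) [].
  apply/tstabP => -[i j]; have := p (i : nat)%:Z (j : nat).
  rewrite /xi addrC wrapD !wrap_val => <-.
  by congr (T (_, _)); rewrite mul1g.
have stabt (m : nat) : (forall x k, xi x (k + m)%N = xi x k) -> wrap t m%:Z = 1%g.
  move=> p; suff /F : (1%g, wrap t m%:Z) \in 'C[T | tact G 'I_n]%g.
    by move=> /(_ (or_introl erefl)) [].
  apply/tstabP => -[i j]; have := p (i : nat)%:Z (j : nat).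
  rewrite /xi addnC PoszD wrapD !wrap_val => <-.
  by congr (T (_, _)); rewrite mul1g.
split=> //; split=> //.
- by move=> x; rewrite /xi wrapD wrap_period mulg1.
- move=> m m0 /(spatial_period_all g) p.
  by apply: dvdn_leq => //; apply: wrap_eq1; apply: stabx => x k; apply: p.
- by move=> x; rewrite /xi wrap_period.
- move=> m m0 /(temporal_period_all g) p.
  by apply: dvdn_leq => //; apply: wrap_eq1; apply: stabt => x k; apply: p.
Qed.

(** The values on one fundamental domain recover the solution by periodicity ([TE]). A nontrivial
    stabilizer element on an axis would be a positive period smaller than the side of the torus. *)
Lemma tile_of_solution (xi : spacetime n) :
  periodic_solution f t.+1 s.+1 xi ->
  [ffun g : G => xi (g.1 : nat)%:Z (g.2 : nat)] \in valid_tiles Zp1 Zp1 f.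
Proof.
case=> g [_ px minx] [_ pt mint]; set T : {ffun G -> 'I_n} := [ffun _ => _].
have per x k : xi (x + (s.+1)%:Z) k = xi x k by apply: spatial_period_all.
have pern x k (q : nat) : xi (x + q%:Z * (s.+1)%:Z) k = xi x k.
  elim: q => [|q IH]; first by rewrite mul0r addr0.
  by rewrite -addn1 PoszD mulrDl mul1r addrA per.
have perz x k (q : int) : xi (x + q * (s.+1)%:Z) k = xi x k.
  case: (intP q) => [|q'|q']; first by rewrite mul0r addr0.
    exact: pern.
  by rewrite -(pern (x + _) k q'.+1) mulNr addrNK.
have pert x k (q : nat) : xi x (k + q * t.+1)%N = xi x k.
  elim: q => [|q IH]; first by rewrite mul0n addn0.
  by rewrite mulSn addnCA addnC addnC (addnC t.+1) (temporal_period_all g pt).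
have TE x k : T (wrap s x, wrap t k%:Z) = xi x k.
  rewrite ffunE /=.
  have [q e] := wrapE s x; rewrite [in RHS]e addrC perz.
  by have [r e'] := wrap_natE t k; rewrite [in RHS]e' addnC pert.
rewrite inE; apply/andP; split.
  apply/forallP => -[i j]; rewrite -[i]wrap_val -[j]wrap_val.
  have := g (i : nat)%:Z (j : nat); rewrite -!TE => e.
  apply/eqP; apply: etrans (etrans e _).
    by rewrite wrapS; congr (T (_, _)); rewrite mul1g.
  congr (f (T (_, _), _)); last by rewrite mul1g.
  by rewrite wrapB1.
apply/axis_freeP => -[i j] /tstabP st /= [ei|ej].
  have jt x : xi x (j : nat) = xi x 0%N.
    rewrite -!TE wrap_val wrap0; have <- := st (wrap s x, 1%g).
    by congr (T (_, _)); rewrite /= ?ei ?mul1g ?mulg1.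
  rewrite ei; congr (_, _); apply/eqP/contraT => j1.
  have j0 : (0 < j)%N by rewrite lt0n; apply: contra j1 => /eqP e; apply/eqP/val_inj.
  by have := mint j j0 jt; rewrite leqNgt ltn_ord.
have ix x : xi (x + (i : nat)%:Z) 0%N = xi x 0%N.
  rewrite -!TE addrC wrapD wrap_val wrap0; have <- := st (wrap s x, 1%g).
  by congr (T (_, _)); rewrite /= ?ej ?mul1g ?mulg1.
rewrite ej; congr (_, _); apply/eqP/contraT => i1.
have i0 : (0 < i)%N by rewrite lt0n; apply: contra i1 => /eqP e; apply/eqP/val_inj.
by have := minx i i0 ix; rewrite leqNgt ltn_ord.
Qed.

Lemma PS_nonempty :
  PS f t.+1 s.+1 !=set0 <-> nb_orbits (Zp1 : 'I_s.+1) (Zp1 : 'I_t.+1) f != 0%N.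
Proof.
rewrite /nb_orbits cards_eq0; split=> [[_ [xi sol _]]|/set0Pn[_ /imsetP[T V _]]].
  pose T := [ffun g : G => xi (g.1 : nat)%:Z (g.2 : nat)].
  apply/set0Pn; exists (orbit (tact G 'I_n) [set: G]%SET T).
  by rewrite imset_f // tile_of_solution.
pose xi x (k : nat) := T (wrap s x, wrap t k%:Z).
by exists (translates xi); exists xi => //; apply: solution_of_tile.
Qed.

End Solutions.

Lemma lambda_intensity (R : realType) (s t : nat) :
  lambda R t.+1 s.+1 = intensity R 'I_s.+1 'I_t.+1.
Proof.
have cyc m : cyclic [set: 'I_m.+1]%SET by apply/cyclicP; exists Zp1; exact: Zp_cycle.
rewrite /intensity (sum_card_axis_free (cyc s) (cyc t)).
have -> : (#|{: 'I_s.+1 * 'I_t.+1}| = t.+1 * s.+1)%N by rewrite card_prod !card_ord mulnC.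
by rewrite !card_ord natr_sum gcdnC mulrC.
Qed.

Theorem theorem1 (R : realType) (tau sigma : nat)
    (htau : (1 <= tau)%N) (hsigma : (1 <= sigma)%N) :
  (fun n : nat =>
     rule_prob R [set f : rule n | PS f tau sigma !=set0]) @ \oo
    --> (1 - expR (- lambda R tau sigma) : R).
Proof.
case: tau sigma htau hsigma => [//|t] [//|s] _ _.
rewrite lambda_intensity.
have H : (fun n => 1 -
    (\sum_(f : rule n) (nb_orbits (Zp1 : 'I_s.+1) (Zp1 : 'I_t.+1) f == 0)%N%:R)
    / (n ^ (n ^ 2))%:R) @ \oo --> (1 - expR (- intensity R 'I_s.+1 'I_t.+1) : R).
  by apply: cvgB; [exact: cvg_cst|exact: cvg_no_orbit (Zp_cycle s) (Zp_cycle t)].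
apply: cvg_trans H; apply: near_eq_cvg; near=> n.
have n0 : (0 < n)%N by near: n; exact: nbhs_infty_gt.
have nz : ((n ^ (n ^ 2))%:R != 0 :> R) by rewrite pnatr_eq0 -lt0n expn_gt0 n0.
rewrite /rule_prob /=.
(* The constant 1 is written as an average over all rules, so that both sides are compared rule by
   rule. *)
have {1}<- : (\sum_(f : rule n) 1) / (n ^ (n ^ 2))%:R = 1 :> R.
  by rewrite sumr_const card_ffun card_prod !card_ord mulnn divff.
rewrite -mulrBl -sumrB mulr_suml [RHS]big_mkcond /=; apply: eq_bigr => f _.
case: ifPn => [/set_mem/PS_nonempty/negbTE->|]; first by rewrite subr0 mul1r.
by case: eqP => [_ _|/eqP/PS_nonempty h /negP[]]; [rewrite subrr mul0r|apply/mem_set].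
Unshelve. all: by end_near. Qed.
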